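(* Let $ABC$ be a triangle, and let $a,b,c$ be the lengths of the sides $\overline{BC}$, $\overline{CA}$ and $\overline{AB}$ respectively. Then the angle at $B$ is twice the angle at $A$ if and only if $b^2=a(a+c)$.
   Context: Triangles are non-degenerate triangles in the Euclidean plane, and the angle at a vertex means the interior angle there. *)

(* Defs.v *)
(* Stdlib real numbers; the Euclidean plane is R * R. *)
From Stdlib Require Import Reals.
Open Scope R_scope.

Definition point : Type := (R * R)%type.

Definition pdist (P Q : point) : R := dist_euc (fst P) (snd P) (fst Q) (snd Q).

(* The line is given by u * x + v * y = w with (u, v) nonzero. *)
Definition collinear (P Q S : point) : Prop :=
  exists u v w : R,
    (u, v) <> (0, 0) /\
    u * fst P + v * snd P = w /\
    u * fst Q + v * snd Q = w /\
    u * fst S + v * snd S = w.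

Definition is_triangle (A B C : point) : Prop := ~ collinear A B C.

(* Scalar product of the vectors from V to P and from V to Q. *)
Definition dot_from (V P Q : point) : R :=
  (fst P - fst V) * (fst Q - fst V) + (snd P - snd V) * (snd Q - snd V).

(* The angle PVQ at the vertex V, in radians, between 0 and PI; it is
   meaningful only when P and Q differ from V (otherwise it divides by 0). *)
Definition angle (P V Q : point) : R :=
  acos (dot_from V P Q / (pdist V P * pdist V Q)).

(* Main.v *)
(* By the law of cosines, cos B = 2 (cos A)^2 - 1 clears denominators to
   (a + c) (b^2 - a (a + c)) (b^2 - (c - a)^2) = 0, whose last factor cannot
   vanish in a non-degenerate triangle. Conversely b^2 = a (a + c) makes cos A
   positive, so 2A <= PI and equality of cosines gives equality of angles. *)
Require Import Defs.
From Stdlib Require Import Reals Lra Psatz.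
Open Scope R_scope.

Lemma pdist_ge0 (P Q : point) : 0 <= pdist P Q.
Proof. apply sqrt_pos. Qed.

Lemma pdist_sq (P Q : point) :
  pdist P Q ^ 2 = (fst P - fst Q) ^ 2 + (snd P - snd Q) ^ 2.
Proof.
unfold pdist, dist_euc, Rsqr; rewrite pow2_sqrt; [ring |].
apply Rplus_le_le_0_compat; apply Rle_0_sqr.
Qed.

Lemma pdist_sym (P Q : point) : pdist P Q = pdist Q P.
Proof. apply distance_symm. Qed.

Lemma law_of_cosines (V P Q : point) :
  2 * dot_from V P Q = pdist V P ^ 2 + pdist V Q ^ 2 - pdist P Q ^ 2.
Proof. rewrite !pdist_sq; unfold dot_from; ring. Qed.

Lemma is_triangle_rot (A B C : point) : is_triangle A B C -> is_triangle B C A.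
Proof. intros H (u & v & w & n & hB & hC & hA); apply H; exists u, v, w; auto. Qed.

(** A vanishing cross product yields a common line: through [V] and [P] if they differ, otherwise
    through [V] and [Q], or the vertical line through [V] when [Q] has the same abscissa. *)
Lemma is_triangle_cross (V P Q : point) :
  is_triangle V P Q ->
  (fst P - fst V) * (snd Q - snd V) - (snd P - snd V) * (fst Q - fst V) <> 0.
Proof.
destruct V as [v1 v2], P as [p1 p2], Q as [q1 q2]; simpl; intros H E; apply H.
destruct (Req_dec p1 v1) as [E1 | N1]; [destruct (Req_dec p2 v2) as [E2 | N2] |].
- subst p1 p2; destruct (Req_dec q1 v1) as [E1 | N1].
  + exists 1, 0, v1; simpl; repeat split; try lra; intros X; injection X; lra.
  + exists (q2 - v2), (v1 - q1), ((q2 - v2) * v1 + (v1 - q1) * v2); simpl.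
    repeat split; try lra; intros X; injection X; lra.
- exists (p2 - v2), (v1 - p1), ((p2 - v2) * v1 + (v1 - p1) * v2); simpl.
  repeat split; try lra; intros X; injection X; lra.
- exists (p2 - v2), (v1 - p1), ((p2 - v2) * v1 + (v1 - p1) * v2); simpl.
  repeat split; try lra; intros X; injection X; lra.
Qed.

Lemma dot_from_sq_lt (V P Q : point) :
  is_triangle V P Q -> dot_from V P Q ^ 2 < (pdist V P * pdist V Q) ^ 2.
Proof.
intros H; apply is_triangle_cross in H.
rewrite Rpow_mult_distr, !pdist_sq; unfold dot_from.
(* Lagrange's identity: the difference of the two sides is the cross product squared. *)
apply Rsqr_pos_lt in H; unfold Rsqr in H; lra.
Qed.

Lemma pdist_gt0 (V P Q : point) : is_triangle V P Q -> 0 < pdist V P.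
Proof.
intros H; apply dot_from_sq_lt in H.
(* If [V] and [P] coincided, the strict bound would put a square below 0. *)
destruct (pdist_ge0 V P) as [L | E]; [exact L |].
rewrite <- E in H; pose proof (pow2_ge_0 (dot_from V P Q)); lra.
Qed.

Lemma cos_angle_bounds (x p : R) : 0 < p -> x ^ 2 < p ^ 2 -> -1 <= x / p <= 1.
Proof.
intros hp h; split; apply (Rmult_le_reg_r p); try assumption;
  unfold Rdiv; rewrite Rmult_assoc, Rinv_l; nra.
Qed.

(** [acos] inverts [cos] only on [0, PI], so the double-angle formula decides the equality only when
    [2 * acos x <= PI]; this is what [0 <= x] expresses. *)
Lemma double_acos (x y : R) :
  -1 <= x <= 1 -> -1 <= y <= 1 ->
  acos y = 2 * acos x <-> 0 <= x /\ y = 2 * x ^ 2 - 1.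
Proof.
intros hx hy.
assert (E : cos (2 * acos x) = 2 * x ^ 2 - 1)
  by (rewrite cos_2a_cos, cos_acos by assumption; ring).
pose proof (acos_bound x); pose proof (acos_bound y); pose proof PI_RGT_0.
split.
- intros e; split.
  + rewrite <- (cos_acos x) by assumption; apply cos_ge_0; lra.
  + rewrite <- E, <- e; symmetry; apply cos_acos; assumption.
- intros [x0 ->]; rewrite <- E; apply acos_cos; split; [lra |].
  enough (acos x <= PI / 2) by lra.
  destruct (Rle_or_lt (acos x) (PI / 2)) as [L | G]; [exact L |].
  assert (cos (acos x) < 0) by (apply cos_lt_0; lra).
  rewrite cos_acos in *; lra.
Qed.

Theorem proposition1 (A B C : point) (a b c : R)
  (hABC : is_triangle A B C)
  (ha : a = pdist B C) (hb : b = pdist C A) (hc : c = pdist A B) :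
  angle A B C = 2 * angle C A B <-> b ^ 2 = a * (a + c).
Proof.
pose proof (is_triangle_rot _ _ _ hABC) as hBCA.
pose proof (is_triangle_rot _ _ _ hBCA) as hCAB.
pose proof (pdist_gt0 _ _ _ hABC) as c0.
pose proof (pdist_gt0 _ _ _ hBCA) as a0.
pose proof (pdist_gt0 _ _ _ hCAB) as b0.
pose proof (dot_from_sq_lt _ _ _ hABC) as dA.
pose proof (dot_from_sq_lt _ _ _ hBCA) as dB.
pose proof (law_of_cosines A B C) as lA.
pose proof (law_of_cosines B C A) as lB.
unfold angle.
(* The angles list their legs in the order opposite to the cyclic one used in [dA], [dB], [lA] and
   [lB]. *)
replace (dot_from B A C) with (dot_from B C A) by (unfold dot_from; ring).
replace (dot_from A C B) with (dot_from A B C) by (unfold dot_from; ring).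
rewrite (pdist_sym A C) in *; rewrite (pdist_sym B A) in *.
rewrite <- ha, <- hb, <- hc in *.
rewrite (Rmult_comm c b) in dA; rewrite (Rmult_comm c a).
assert (ac0 : 0 < a * c) by nra; assert (bc0 : 0 < b * c) by nra.
rewrite double_acos by (apply cos_angle_bounds; assumption).
set (x := dot_from A B C) in *; set (y := dot_from B C A) in *.
assert (ex : x = (c ^ 2 + b ^ 2 - a ^ 2) / 2) by lra.
assert (ey : y = (a ^ 2 + c ^ 2 - b ^ 2) / 2) by lra.
assert (F : y / (a * c) - (2 * (x / (b * c)) ^ 2 - 1) =
  - (a + c) * (b ^ 2 - a * (a + c)) * (b ^ 2 - (c - a) ^ 2) / (2 * a * b ^ 2 * c ^ 2))
  by (rewrite ex, ey; field; lra).
split.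
- intros [_ e]; rewrite e, Rminus_diag in F.
  (* If this vanished, [ey] would give [y = a * c], the equality case of Cauchy-Schwarz at [B],
     which [dB] excludes. *)
  assert (N : b ^ 2 - (c - a) ^ 2 <> 0)
    by (intros n; replace y with (a * c) in dB by lra; lra).
  assert (D : 0 < 2 * a * b ^ 2 * c ^ 2)
    by (repeat apply Rmult_lt_0_compat; try apply pow_lt; lra).
  (* The quotient is a product with the inverse of the denominator, nonzero by [D]; as [a + c] is
     positive and [N] removes the last factor, only the desired one can vanish. *)
  symmetry in F; apply Rmult_integral in F; destruct F as [F | F].
  + apply Rmult_integral in F; destruct F as [F | F]; [| contradiction].
    apply Rmult_integral in F; destruct F; lra.
  + apply Rinv_0_lt_compat in D; lra.
- intros e; split.
  (* Substituting [b ^ 2] in [ex] gives [2 * x = c * (a + c)]. *)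
  + apply Rmult_le_pos; [nra | left; apply Rinv_0_lt_compat; assumption].
  + apply Rminus_diag_uniq; rewrite F, e; unfold Rdiv; ring.
Qed.
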